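(* Let $\alpha\in[0,1]$. (a) Let $G_1$ and $G_2$ be regular graphs and let $H$ be an arbitrary graph. If $G_1$ and $G_2$ are $A_\alpha$-cospectral, then $G_1\underline\vee_T H$ and $G_2\underline\vee_T H$ are $A_\alpha$-cospectral. (b) Let $G$ be a regular graph and let $H_1$ and $H_2$ be graphs with $\Upsilon_{A_\alpha(H_1)}(\nu)=\Upsilon_{A_\alpha(H_2)}(\nu)$. If $H_1$ and $H_2$ are $A_\alpha$-cospectral, then $G\underline\vee_T H_1$ and $G\underline\vee_T H_2$ are $A_\alpha$-cospectral.
   Context: All graphs are finite, undirected and simple. For a graph $G$ with adjacency matrix $A(G)$ and diagonal degree matrix $D(G)$, put $A_\alpha(G)=\alpha D(G)+(1-\alpha)A(G)$. The $A_\alpha$-spectrum of $G$ is the multiset of eigenvalues of $A_\alpha(G)$. Two non-isomorphic graphs possessing the same $A_\alpha$-spectrum are called $A_\alpha$-cospectral. For an $n\times n$ matrix $M$, the $M$-coronal is the rational function $\Upsilon_M(\nu)=\mathbf 1_n^T(\nu I_n-M)^{-1}\mathbf 1_n$, where $\mathbf 1_n$ is the all-ones column vector. The total graph $T(G)$ is obtained from $G$ (keeping all its vertices and edges) by adding one new vertex for every edge of $G$, making each new vertex adjacent to the two end vertices of the corresponding edge, and making two new vertices adjacent whenever their corresponding (distinct) edges share an endpoint in $G$. The $T$-edge join $G_1\underline\vee_T G_2$ is obtained from the disjoint union of $T(G_1)$ and $G_2$ by joining each newly added vertex of $T(G_1)$ to every vertex of $G_2$. *)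

(* Defs.v *)
From mathcomp Require Import all_boot all_order all_algebra.
From mathcomp Require Import complex reals.

Set Implicit Arguments.
Unset Strict Implicit.
Unset Printing Implicit Defensive.

Import Order.TTheory GRing.Theory Num.Theory.

Local Open Scope ring_scope.

(* As is standard, a graph has at least one vertex. *)
Record sgraph := SGraph {
  vertex :> finType;
  adj : rel vertex;
  adj_sym : symmetric adj;
  adj_irrefl : irreflexive adj;
  vertex_gt0 : (0 < #|vertex|)%N
}.

Definition isomorphic (G1 G2 : sgraph) : Prop :=
  exists2 f : G1 -> G2, bijective f & {mono f : x y / adj x y}.

Definition degree (G : sgraph) (x : G) : nat := #|[set y | adj x y]|.

Definition regular (G : sgraph) : Prop :=
  exists r : nat, forall x : G, degree x = r.

Section Spectrum.
Variable R : realType.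

(* Matrices of a graph are indexed by its vertices through [enum_val]. *)
Definition adjacency_mx (G : sgraph) : 'M[R]_#|G| :=
  \matrix_(i, j) (adj (enum_val i) (enum_val j))%:R.

Definition degree_mx (G : sgraph) : 'M[R]_#|G| :=
  diag_mx (\row_i (degree (enum_val i))%:R).

Definition Aalpha (alpha : R) (G : sgraph) : 'M[R]_#|G| :=
  alpha *: degree_mx G + (1 - alpha) *: adjacency_mx G.

(* The eigenvalues are the complex roots of the characteristic polynomial,
   listed with their multiplicities. The order of the list is irrelevant:
   spectra are only compared up to permutation, that is, as multisets. *)
Definition spectrum (n : nat) (M : 'M[R]_n) : seq R[i] :=
  sval (closed_field_poly_normal (map_poly (real_complex R) (char_poly M))).

Definition cospectral (alpha : R) (G1 G2 : sgraph) : Prop :=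
  ~ isomorphic G1 G2 /\
  perm_eq (spectrum (Aalpha alpha G1)) (spectrum (Aalpha alpha G2)).

(* [char_poly_mx M] is the polynomial matrix 'X%:M - M; it is inverted over the
   field of rational functions, where it is always invertible. *)
Definition coronal (n : nat) (M : 'M[R]_n) : {fraction {poly R}} :=
  ((const_mx 1 : 'cV_n)^T *m
     invmx (map_mx (@tofrac {poly R}) (char_poly_mx M)) *m
     (const_mx 1 : 'cV_n)) 0 0.

End Spectrum.

Definition is_edge (G : sgraph) (e : {set G}) : bool :=
  [exists x : G, exists y : G, adj x y && (e == [set x; y])].

Definition edge (G : sgraph) : finType := {e : {set G} | is_edge e}.

Section TotalGraph.
Variable G : sgraph.

Definition total_adj : rel (G + edge G) := fun a b =>
  match a, b with
  | inl x, inl y => adj x y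
  | inl x, inr e => x \in val e
  | inr e, inl x => x \in val e
  | inr e, inr f => (e != f) && (val e :&: val f != set0)
  end.

Fact total_adj_sym : symmetric total_adj.
Proof.
by move=> [x|e] [y|f] //=; [exact: adj_sym | rewrite eq_sym setIC].
Qed.

Fact total_adj_irrefl : irreflexive total_adj.
Proof. by move=> [x|e] /=; [exact: adj_irrefl | rewrite eqxx]. Qed.

Fact total_gt0 : (0 < #|{: G + edge G}|)%N.
Proof. by rewrite card_sum addn_gt0 vertex_gt0. Qed.

Definition total_graph : sgraph :=
  SGraph total_adj_sym total_adj_irrefl total_gt0.

End TotalGraph.

Section TEdgeJoin.
Variables G1 G2 : sgraph.

Definition is_new (a : total_graph G1) : bool := if a is inr _ then true else false.

Definition tejoin_adj : rel (total_graph G1 + G2) := fun a b =>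
  match a, b with
  | inl s, inl t => adj s t
  | inl s, inr _ => is_new s
  | inr _, inl t => is_new t
  | inr x, inr y => adj x y
  end.

Fact tejoin_adj_sym : symmetric tejoin_adj.
Proof. by move=> [s|x] [t|y] //; exact: adj_sym. Qed.

Fact tejoin_adj_irrefl : irreflexive tejoin_adj.
Proof. by move=> [s|x]; exact: adj_irrefl. Qed.

Fact tejoin_gt0 : (0 < #|{: total_graph G1 + G2}|)%N.
Proof. by rewrite card_sum addn_gt0 vertex_gt0. Qed.

Definition T_edge_join : sgraph :=
  SGraph tejoin_adj_sym tejoin_adj_irrefl tejoin_gt0.

End TEdgeJoin.

(* Main.v *)
Require Import Defs.
From HB Require Import structures.
From mathcomp Require Import all_boot all_order all_fingroup all_algebra.
From mathcomp Require Import complex reals spectral zify ring.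

Set Implicit Arguments.
Unset Strict Implicit.
Unset Printing Implicit Defensive.

Import Order.TTheory GRing.Theory Num.Theory.

(** Let [G] be r-regular with incidence matrix [B], so that [B B^T = A(G) + rI]
and the line graph has adjacency matrix [B^T B - 2I]. A Schur complement with
respect to the block of [H] turns the characteristic matrix of the join into
the one of [H] and a 2 x 2 block matrix in [B] perturbed by a multiple of the
all-ones matrix [J], the multiple being the coronal of [H]. Since
[B J = r J] and [B^T J = 2 J], eliminating the off-diagonal blocks leaves the
determinant of a quadratic polynomial in [B B^T], up to factors depending only
on the orders and on [r]. The argument of the coronal is shifted by
[alpha * |E(G)|], which a substitution in the variable undoes. For (a), real
symmetric matrices with equal characteristic polynomials are similar over the
complex numbers, and the degree is recovered from the trace of the square.

The joins are not isomorphic: degrees single out the vertices coming from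
edges; deleting them leaves the disjoint union [G + H], and a common summand of
isomorphic disjoint unions can be cancelled. *)

(** * Cancellation in disjoint unions *)

(** The orbit of [u] under [f], where each value in [Z] is fed back as an argument; [y] is the value
    at which the orbit leaves [Z]. It is a relation because termination is a separate matter,
    settled by finiteness and injectivity. *)
Inductive walk (Z X Y : Type) (f : Z + X -> Z + Y) : Z + X -> Y -> Prop :=
  | walk_stop u y : f u = inr y -> walk f u y
  | walk_step u z y : f u = inl z -> walk f (inl z) y -> walk f u y.

Lemma walk_fun (Z X Y : Type) (f : Z + X -> Z + Y) u y y' :
  walk f u y -> walk f u y' -> y = y'.
Proof.
move=> wy; elim: wy y' => {u y} [u y fu|u z y fu _ IH] y' wy'.
  by case: wy' fu => [v w ->|v z w ->] // [].
by case: wy' fu => [v w ->|v z' w -> wy'] // [ez]; apply: IH; rewrite -ez.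
Qed.

Lemma walk_total (Z : finType) (X Y : Type) (f : Z + X -> Z + Y) g x :
  cancel f g -> exists y, walk f (inr x) y.
Proof.
move=> fK.
(* S collects the vertices of Z visited so far; injectivity of f forbids a return. *)
have walkS n (S : {set Z}) u : (#|~: S| <= n)%N ->
    (forall z, u = inl z -> z \in S) ->
    (forall z, z \in S -> g (inl z) <> u) ->
    (forall z z', z \in S -> g (inl z) = inl z' -> z' \in S) ->
    exists y, walk f u y.
  elim: n S u => [|n IH] S u leSn uS Su SS; case fu : (f u) => [z|y];
    try (by exists y; exact: walk_stop);
    have gz : g (inl z) = u by rewrite -fu fK.
    have: z \in ~: S by rewrite inE; apply/negP => /Su /(_ gz).
    by move: leSn; rewrite leqn0 cards_eq0 => /eqP->; rewrite inE.
  (* By [Su] the predecessor [u] of [z] precedes no visited vertex, so [z] is new. Adding it to [S]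
     lowers the bound on unvisited vertices, and closure of [S] under predecessors restores the
     hypotheses at [inl z]. *)
  have zS : z \notin S by apply/negP => /Su /(_ gz).
  have [|z0 [<-]|z0|z0 z1|y wy] := IH (z |: S) (inl z).
  - rewrite -ltnS (leq_trans _ leSn) // proper_card // setCU setIC properEneq
    subsetIl andbT.
    apply: contraNneq zS => /setP /(_ z); rewrite !inE eqxx andbF => /esym/negbT.
    by rewrite negbK.
  - by rewrite setU11.
  - case/setU1P => [->|z0S] gz0; last by move: zS; rewrite (SS z0).
    by move: zS; rewrite uS // -gz.
  - case/setU1P => [->|z0S] gz0; apply/setU1P; right; last exact: SS gz0.
    by apply: uS; rewrite -gz.
  by exists y; apply: walk_step fu wy.
by apply: (walkS _ set0 _ (leqnn _)) => [z|z|z z']; rewrite ?inE.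
Qed.

Lemma walk_rev (Z X Y : Type) (f : Z + X -> Z + Y) g x y :
  cancel f g -> walk f (inr x) y -> walk g (inr y) x.
Proof.
(* The condition on [u] says that the part of the walk from [inr x] to [u] is already reversed. *)
move=> fK; have rev u : walk f u y ->
    (u = inr x \/ exists2 z, u = inl z & walk g (inl z) x) -> walk g (inr y) x.
  elim=> {u y} [u y fu|u z y fu _ IH] ux.
    by case: ux fu => [|[z]] -> => [|wz] fu;
      [apply: walk_stop|apply: (walk_step _ wz)]; rewrite -fu fK.
  apply: IH; right; exists z => //.
  by case: ux fu => [|[z']] -> => [|wz] fu;
    [apply: walk_stop|apply: (walk_step _ wz)]; rewrite -fu fK.
by move=> /rev; apply; left.
Qed.

Section DisjointUnion.
Variables G H : sgraph.

Definition dunion_adj : rel (G + H) := fun a b =>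
  match a, b with
  | inl x, inl y => adj x y
  | inr x, inr y => adj x y
  | _, _ => false
  end.

Fact dunion_adj_sym : symmetric dunion_adj.
Proof. by move=> [x|x] [y|y] //; exact: adj_sym. Qed.

Fact dunion_adj_irrefl : irreflexive dunion_adj.
Proof. by move=> [x|x]; exact: adj_irrefl. Qed.

Fact dunion_gt0 : (0 < #|{: G + H}|)%N.
Proof. by rewrite card_sum addn_gt0 vertex_gt0. Qed.

Definition dunion : sgraph := SGraph dunion_adj_sym dunion_adj_irrefl dunion_gt0.
End DisjointUnion.

Lemma isomorphic_trans G1 G2 G3 :
  isomorphic G1 G2 -> isomorphic G2 G3 -> isomorphic G1 G3.
Proof.
move=> [f fb fA] [g gb gA]; exists (g \o f); first exact: bij_comp.
by move=> x y; rewrite /= gA fA.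
Qed.

Lemma dunionC G H : isomorphic (dunion G H) (dunion H G).
Proof.
pose swap G H (u : dunion G H) : dunion H G :=
  match u with inl x => inr x | inr y => inl y end.
exists (swap G H); first by exists (swap H G) => [] [].
by move=> [x|x] [y|y].
Qed.

(** No edge joins the two summands, so [f] sends adjacent vertices to the same summand at every
    step: both walks stop together or continue from adjacent vertices. *)
Lemma walk_adj (G H1 H2 : sgraph) (f : dunion G H1 -> dunion G H2) :
  {mono f : x y / adj x y} ->
  forall (u u' : dunion G H1) (y y' : H2), walk f u y -> walk f u' y' ->
    adj u u' -> adj y y'.
Proof.
move=> fA u u' y y' wy.
elim: wy u' y' => {u y} [u y fu|u z y fu _ IH] u' y' wy' uu'.
  case: wy' uu' => {u' y'} [u' y' fu'|u' z' y' fu' _]; rewrite -fA fu fu' //.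
case: wy' uu' => {u' y'} [u' y' fu'|u' z' y' fu' wy']; rewrite -fA fu fu' // => zz'.
exact: IH wy' zz'.
Qed.

(* An isomorphism f from G + H1 to G + H2 sends x in H1 to the first of
   f x, f (f x), ... that leaves G; adjacent vertices leave G simultaneously. *)
Lemma dunion_cancel G H1 H2 :
  isomorphic (dunion G H1) (dunion G H2) -> isomorphic H1 H2.
Proof.
move=> [f [g fK gK] fA].
have gA : {mono g : x y / adj x y} by move=> x y; rewrite -fA !gK.
have [k kP] := fin_all_exists (fun x : H1 => walk_total x fK).
have [l lP] := fin_all_exists (fun y : H2 => walk_total y gK).
have kK : cancel k l by move=> x; apply: walk_fun (lP _) (walk_rev fK (kP x)).
have lK : cancel l k by move=> y; apply: walk_fun (kP _) (walk_rev gK (lP y)).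
exists k; first by exists l.
move=> x y; apply/idP/idP => xy.
  by apply: (walk_adj gA (walk_rev fK (kP x)) (walk_rev fK (kP y))).
exact: (walk_adj fA (kP x) (kP y)).
Qed.

(** * Degrees in the T-edge join *)

Lemma degree_sum (G : sgraph) (x : G) : degree x = (\sum_(y : G) adj x y)%N.
Proof.
by rewrite /degree -sum1_card big_mkcond; apply: eq_bigr => y _; rewrite inE;
  case: adj.
Qed.

Lemma edge_set2 (G : sgraph) (e : edge G) :
  exists x y : G, [/\ adj x y, x != y & val e = [set x; y]].
Proof.
have /existsP[x /existsP[y /andP[xy /eqP ee]]] := valP e.
by exists x, y; split=> //; apply: contraTneq xy => ->; rewrite adj_irrefl.
Qed.

Lemma card_edge (G : sgraph) (e : edge G) : #|val e| = 2.
Proof. by have [x [y [_ xy ->]]] := edge_set2 e; rewrite cards2 xy. Qed.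

Lemma is_edge_set2 (G : sgraph) (x y : G) : is_edge [set x; y] = adj x y.
Proof.
apply/existsP/idP => [[a /existsP[b /andP[ab /eqP eab]]]|xy]; last first.
  by exists x; apply/existsP; exists y; rewrite xy eqxx.
have /set2P xab : x \in [set a; b] by rewrite -eab set21.
have /set2P yab : y \in [set a; b] by rewrite -eab set22.
have ca : a != b by apply: contraTneq ab => ->; rewrite adj_irrefl.
have : #|[set x; y]| = 2 by rewrite eab cards2 ca.
rewrite cards2; case: eqP => // xy _.
case: xab yab xy => -> [] -> // _; by rewrite adj_sym.
Qed.

Lemma sum_edge_set2 (G : sgraph) (x y : G) :
  (\sum_(e : edge G) (val e == [set x; y]))%N = adj x y.
Proof.
case: (boolP (adj x y)) => [xy|nxy]; last first.
  rewrite big1 // => e _; case: eqP => // ee; case/negP: nxy.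
  by rewrite -is_edge_set2 -ee (valP e).
have xyE : is_edge [set x; y] by rewrite is_edge_set2.
pose e0 : edge G := Sub [set x; y] xyE.
rewrite (bigD1 e0) //= eqxx big1 // => e; case: (val e =P _) => // ee /negP[].
by apply/eqP/val_inj.
Qed.

(** Turns incidence into a sum over the possible other endpoints, ready for the exchange of sums
    that counts the edges at a vertex. *)
Lemma edge_endpoint (G : sgraph) (e : edge G) (x : G) :
  (x \in val e : nat) = (\sum_(y : G) (val e == [set x; y]))%N.
Proof.
have [a [b [ab ca ee]]] := edge_set2 e; rewrite ee.
have cb : b != a by rewrite eq_sym.
have eqb (u v w : G) : u != v -> ([set u; v] == [set u; w]) = (w == v).
  move=> uv; apply/eqP/eqP => [/setP /(_ v)|-> //].
  by rewrite !inE eqxx orbT [v == u]eq_sym (negbTE uv) => /esym/eqP.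
rewrite !inE; case: (x =P a) => [->|/eqP xa] /=.
  rewrite (bigD1 b) //= eqxx big1 // => y yb.
  by rewrite eqb // (negbTE yb).
case: (x =P b) => [->|/eqP xb] /=.
  rewrite setUC (bigD1 a) //= eqxx big1 // => y ya.
  by rewrite eqb // (negbTE ya).
rewrite big1 // => y _; case: eqP => // /setP /(_ x).
by rewrite !inE (negbTE xa) (negbTE xb) eqxx.
Qed.

Lemma sum_incident (G : sgraph) (x : G) :
  (\sum_(e : edge G) (x \in val e))%N = degree x.
Proof.
under eq_bigr => e _ do rewrite edge_endpoint.
by rewrite exchange_big degree_sum; apply: eq_bigr => y _; rewrite sum_edge_set2.
Qed.

(** Entrywise form of [B B^T = A + D]: the only edge containing two distinct vertices [x] and [y] is
    [[set x; y]]. *)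
Lemma sum_incident2 (G : sgraph) (x y : G) :
  (\sum_(e : edge G) (x \in val e) * (y \in val e))%N =
  (adj x y + (x == y) * degree x)%N.
Proof.
case: (x =P y) => [<-|/eqP xy].
  rewrite adj_irrefl mul1n -sum_incident; apply: eq_bigr => e _.
  by case: (_ \in _).
rewrite addn0 -sum_edge_set2; apply: eq_bigr => e _.
case: (val e =P _) => [->|ne]; first by rewrite !inE !eqxx orbT.
case xe : (x \in val e); case ye : (y \in val e) => //; case: ne.
by apply/esym/eqP; rewrite eqEcard subUset !sub1set xe ye cards2 xy card_edge.
Qed.

Lemma sum_ends (G : sgraph) (e : edge G) : (\sum_(x : G) (x \in val e))%N = 2.
Proof.
by rewrite -(card_edge e) -sum1_card [RHS]big_mkcond; apply: eq_bigr => x _;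
  case: (_ \in _).
Qed.

(** Entrywise form of [B^T B = 2I + A(L)] for the line graph [L]: distinct two-element sets meet in
    at most one vertex. *)
Lemma sum_common_ends (G : sgraph) (e f : edge G) :
  (\sum_(x : G) (x \in val e) * (x \in val f))%N =
  ((e == f) * 2 + ((e != f) && (val e :&: val f != set0)))%N.
Proof.
case: (e =P f) => [<-|/eqP ef] /=.
  by rewrite addn0 mul1n -(sum_ends e); apply: eq_bigr => x _; case: (_ \in _).
have -> : (\sum_(x : G) (x \in val e) * (x \in val f))%N = #|val e :&: val f|.
  by rewrite -sum1_card [RHS]big_mkcond; apply: eq_bigr => x _; rewrite inE;
    do 2!case: (_ \in _).
rewrite -card_gt0; case: ltnP; last by rewrite leqn0 => /eqP.
move=> gt0; apply/eqP; rewrite eqn_leq gt0 andbT -ltnS.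
rewrite -(card_edge e) proper_card // properEneq subsetIl andbT.
apply: contraNneq ef => efe; apply/eqP/val_inj/eqP.
by rewrite eqEcard !card_edge leqnn andbT; apply/setIidPl.
Qed.

Lemma degree_old (G H : sgraph) (r : nat) (x : G) : (forall x : G, degree x = r) ->
  degree (inl (inl x) : T_edge_join G H) = (2 * r)%N.
Proof.
move=> reg; rewrite degree_sum big_sumType big_sumType /= -degree_sum sum_incident.
by rewrite big1 // reg; lia.
Qed.

Lemma degree_new (G H : sgraph) (r : nat) (e : edge G) :
  (forall x : G, degree x = r) ->
  degree (inl (inr e) : T_edge_join G H) = (2 * r + #|H|)%N.
Proof.
move=> reg; rewrite degree_sum big_sumType big_sumType /= sum1_card.
congr (_ + _)%N.
(* In this double count the term [f = e] equals 2, which is also the number of old neighbours of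
   [e]; the other terms count its new neighbours. *)
have : (\sum_(f : edge G) \sum_(x : G) (x \in val e) * (x \in val f) = 2 * r)%N.
  rewrite exchange_big; under eq_bigr => x _ do rewrite -big_distrr /=
    sum_incident reg.
  by rewrite -big_distrl sum_ends.
under eq_bigr => f _ do rewrite sum_common_ends.
rewrite big_split /= => <-; congr (_ + _)%N; rewrite sum_ends.
rewrite (bigD1 e) //= eqxx big1 // => f; rewrite eq_sym.
by case: eqP.
Qed.

Lemma degree_joined (G H : sgraph) (y : H) :
  degree (inr y : T_edge_join G H) = (degree y + #|edge G|)%N.
Proof.
rewrite degree_sum big_sumType big_sumType /= big1 // sum1_card degree_sum.
by rewrite add0n addnC.
Qed.

Lemma degree_lt (G : sgraph) (x : G) : (degree x < #|G|)%N.
Proof.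
rewrite -cardsT; apply: proper_card; rewrite properEneq subsetT andbT.
by apply/eqP => /setP /(_ x); rewrite !inE adj_irrefl.
Qed.

Lemma degree_iso (G1 G2 : sgraph) (f : G1 -> G2) (x : G1) :
  bijective f -> {mono f : x y / adj x y} -> degree (f x) = degree x.
Proof.
move=> fb fA; rewrite !degree_sum (reindex f) /=; last exact: onW_bij.
by apply: eq_bigr => y _; rewrite fA.
Qed.

(* When 2r < #|edge G|, a joined vertex has degree above 2r, so the old vertices
   are those of degree 2r; otherwise the new vertices have the largest degrees. *)
Lemma new_vertexP (G H : sgraph) (r : nat) (u : T_edge_join G H) :
  (forall x : G, degree x = r) ->
  (exists e, u = inl (inr e)) <->
  (if (#|edge G| <= 2 * r)%N then (2 * r + #|H| <= degree u)%N
   else (degree u != 2 * r)%N && [exists v, adj u v && (degree v == 2 * r)%N]).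
Proof.
move=> reg; split=> [[e ->]|].
  rewrite (degree_new _ _ reg); case: leqP => // _.
  have H0 := vertex_gt0 H; apply/andP; split; first by lia.
  have [x [y [xy _ ee]]] := edge_set2 e.
  apply/existsP; exists (inl (inl x)); rewrite (degree_old _ _ reg) eqxx andbT.
  by rewrite /= ee set21.
case: u => [[x|e]|y]; last 1 first.
- rewrite degree_joined; have yH := degree_lt y; case: leqP => rm.
    by move=> ?; exfalso; lia.
  case/andP=> _ /existsP[[[x|e]|z]] //= /eqP.
    rewrite (degree_new _ _ reg); have := vertex_gt0 H; lia.
  rewrite degree_joined; lia.
- rewrite (degree_old _ _ reg) eqxx; case: leqP => // _.
  have := vertex_gt0 H; lia.
by exists e.
Qed.

(** The criterion of [new_vertexP] uses only degrees, adjacency and numbers common to both joins, so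
    an isomorphism preserves new vertices. It therefore restricts to the remaining ones, on which a
    join induces the disjoint union. *)
Lemma dunion_of_join (G1 G2 H1 H2 : sgraph) r :
  (forall x : G1, degree x = r) -> (forall x : G2, degree x = r) ->
  #|G1| = #|G2| -> #|H1| = #|H2| ->
  isomorphic (T_edge_join G1 H1) (T_edge_join G2 H2) ->
  isomorphic (dunion G1 H1) (dunion G2 H2).
Proof.
move=> reg1 reg2 eqG eqH [f [g fK gK] fA].
have fb : bijective f by exists g.
have gb : bijective g by exists f.
have gA : {mono g : x y / adj x y} by move=> x y; rewrite -fA !gK.
have eqm : #|edge G1| = #|edge G2|.
  by have := bij_eq_card fb; rewrite !card_sum eqG eqH => /addIn/addnI.
have fnew (u : T_edge_join G1 H1) :
    (exists e, u = inl (inr e)) <-> (exists e, f u = inl (inr e)).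
  rewrite (new_vertexP u reg1) (new_vertexP (f u) reg2) eqm eqH.
  rewrite (degree_iso u fb fA).
  suff -> : [exists v, adj u v && (degree v == 2 * r)%N] =
            [exists v, adj (f u) v && (degree v == 2 * r)%N] by [].
  apply/existsP/existsP => [[v uv]|[v uv]].
    by exists (f v); rewrite fA degree_iso.
  by exists (g v); rewrite -fA gK degree_iso.
pose emb G H (u : dunion G H) : T_edge_join G H :=
  match u with inl x => inl (inl x) | inr y => inr y end.
have embA G H : {mono emb G H : u v / adj u v} by move=> [x|x] [y|y].
have embI G H : injective (emb G H) by move=> [x|x] [y|y] // [->].
have emb_new G H u : ~ (exists e, emb G H u = inl (inr e)) by case: u => [x|y] [].
have embP G H u : ~ (exists e, u = inl (inr e)) -> exists v, u = emb G H v.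
  by case: u => [[x|e]|y] nu; [exists (inl x)|case: nu; exists e|exists (inr y)].
have [|k kP] := @fin_all_exists (dunion G1 H1) _ (fun u v => f (emb _ _ u) =
  emb G2 H2 v).
  by move=> u; apply: embP => /fnew; exact: emb_new.
have [|l lP] := @fin_all_exists (dunion G2 H2) _ (fun u v => g (emb _ _ u) =
  emb G1 H1 v).
  by move=> u; apply: embP => /fnew; rewrite gK; exact: emb_new.
exists k; last by move=> u v; rewrite -embA -!kP fA embA.
by exists l => u; apply: embI; [rewrite -lP -kP fK|rewrite -kP -lP gK].
Qed.

(** * Similarity and block determinants *)

Local Open Scope ring_scope.

(** Changing the enumeration permutes rows and columns alike, and the two signs cancel. This allows
    an enumeration of the join adapted to its blocks. *)
Lemma det_reindex (R : comNzRingType) (T : finType) n1 n2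
    (g1 : 'I_n1 -> T) (g2 : 'I_n2 -> T) (F : T -> T -> R) :
  bijective g1 -> bijective g2 ->
  \det (\matrix_(i, j) F (g1 i) (g1 j)) = \det (\matrix_(i, j) F (g2 i) (g2 j)).
Proof.
move=> bij1 bij2; have eqn : n1 = n2.
  by rewrite -[n1]card_ord -[n2]card_ord (bij_eq_card bij1) (bij_eq_card bij2).
case: n2 / eqn g2 bij2 => g2 [h2 g2K h2K].
have inj_h : injective (h2 \o g1) by apply: inj_comp;
  [exact: can_inj h2K | exact: bij_inj].
pose s := perm inj_h.
have -> : (\matrix_(i, j) F (g1 i) (g1 j)) =
    row_perm s (col_perm s (\matrix_(i, j) F (g2 i) (g2 j))).
  by apply/matrixP => i j; rewrite !mxE !permE /= !h2K.
rewrite row_permE col_permE !det_mulmx !det_perm odd_permV.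
by rewrite mulrCA -signr_addb addbb mulr1.
Qed.

(* S and T are rectangular because the orders of two cospectral graphs are equal
   but not convertible. *)
Definition similar_mx (R : pzRingType) n1 n2 (A1 : 'M[R]_n1) (A2 : 'M[R]_n2) :=
  exists (S : 'M_(n1, n2)) (T : 'M_(n2, n1)),
    [/\ S *m T = 1%:M, T *m S = 1%:M & A1 *m S = S *m A2].

Lemma similar_map (R R' : pzRingType) (f : {rmorphism R -> R'}) n1 n2
    (A1 : 'M[R]_n1) (A2 : 'M[R]_n2) :
  similar_mx A1 A2 -> similar_mx (map_mx f A1) (map_mx f A2).
Proof.
move=> [S [T [ST TS AS]]]; exists (map_mx f S), (map_mx f T).
by split; rewrite -!map_mxM ?ST ?TS ?AS ?map_mx1.
Qed.

Lemma char_poly_order (R : nzRingType) n1 n2 (A1 : 'M[R]_n1) (A2 : 'M[R]_n2) :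
  char_poly A1 = char_poly A2 -> n1 = n2.
Proof.
by move=> eqA; apply: succn_inj; rewrite -(size_char_poly A1) eqA size_char_poly.
Qed.

(** Both matrices are diagonalizable by the spectral theorem, and equal characteristic polynomials
    make the two diagonals agree up to a permutation [s]; the similarity combines the two eigenbases
    with [s]. *)
Lemma normal_similar (C : numClosedFieldType) n1 n2
    (A1 : 'M[C]_n1) (A2 : 'M[C]_n2) :
  A1 \is normalmx -> A2 \is normalmx -> char_poly A1 = char_poly A2 ->
  similar_mx A1 A2.
Proof.
move=> nA1 nA2 eqA; have eqn := char_poly_order eqA.
case: n2 / eqn A2 nA2 eqA => A2 /orthomx_spectralP eA2 eqA.
have/orthomx_spectralP eA1 := nA1.
have U1 := spectral_unit A1; have U2 := spectral_unit A2.
move: (spectralmx A1) (spectralmx A2) U1 U2 eA1 eA2 => P1 P2 U1 U2.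
move: (spectral_diag A1) (spectral_diag A2) => d1 d2 eA1 eA2.
have charE (A P : 'M[C]_n1) d : P \in unitmx -> A = invmx P *m diag_mx d *m P ->
    char_poly A = \prod_(a <- [tuple d 0 i | i < n1]) ('X - a%:P).
  move=> uP ->; have -> : char_poly (invmx P *m diag_mx d *m P) =
    char_poly (diag_mx d).
    rewrite /char_poly; have -> : char_poly_mx (invmx P *m diag_mx d *m P) =
        map_mx polyC (invmx P) *m char_poly_mx (diag_mx d) *m map_mx polyC P.
      rewrite /char_poly_mx mulmxBr mulmxBl -!map_mxM; congr (_ - _).
      by rewrite -scalemx1 -scalemxAr -scalemxAl mulmx1 -map_mxM mulVmx // map_mx1.
    rewrite !det_mulmx mulrAC -det_mulmx -map_mxM mulVmx // map_mx1 det1.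
    by rewrite mul1r.
  rewrite char_poly_trig ?diag_mx_is_trig // big_map big_enum /=.
  by apply: eq_bigr => i _; rewrite mxE eqxx.
have/tuple_permP[s es] : perm_eq [tuple d1 0 i | i < n1] [tuple d2 0 i | i < n1].
  apply: prod_XsubC_eq; rewrite /= -(charE A1 P1 d1 U1 eA1) eqA.
  exact: charE U2 eA2.
have d12 i : d1 0 i = d2 0 (s i).
  by have := congr1 (fun t => tnth t i) (val_inj es); rewrite !tnth_mktuple.
exists (invmx P1 *m perm_mx s *m P2), (invmx P2 *m perm_mx s^-1 *m P1); split.
- by rewrite -!mulmxA mulKVmx // [perm_mx s *m _]mulmxA -perm_mxM mulgV perm_mx1
  mul1mx mulVmx.
- by rewrite -!mulmxA mulKVmx // [perm_mx _ *m (_ *m P2)]mulmxA -perm_mxM mulVg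
  perm_mx1 mul1mx mulVmx.
rewrite {1}eA1 eA2 -!mulmxA mulKVmx // (mulKVmx U2); congr (_ *m _).
rewrite !mulmxA; congr (_ *m _); apply/matrixP => i j.
rewrite mul_diag_mx mul_mx_diag !mxE d12 mulrC.
by case: eqP => [->|_]; rewrite ?mul0r.
Qed.

(** * Schur complements and the determinant of the total-graph block *)

Lemma det_schur_dr (F : fieldType) n m (P : 'M[F]_n) (Q : 'M_(n, m)) W (N : 'M_m) :
  N \in unitmx ->
  \det (block_mx P Q W N) = \det N * \det (P - Q *m invmx N *m W).
Proof.
move=> uN; have := congr1 determinant
  (mulmx_block P Q W N 1%:M 0 (- (invmx N *m W)) 1%:M).
rewrite det_mulmx det_lblock !det1 !mulr1 !mulmx0 !mulmx1 add0r !mulmxN mulKVmx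
  // subrr.
by rewrite add0r det_ublock mulmxA mulrC.
Qed.

Lemma det_schur_ul (F : fieldType) n m (P : 'M[F]_n) (Q : 'M_(n, m)) W (N : 'M_m) :
  P \in unitmx ->
  \det (block_mx P Q W N) = \det P * \det (N - W *m invmx P *m Q).
Proof.
move=> uP; have := congr1 determinant
  (mulmx_block P Q W N 1%:M (- (invmx P *m Q)) 0 1%:M).
rewrite det_mulmx det_ublock !det1 !mulr1 !mulmx0 !mulmx1 addr0 !mulmxN mulKVmx
  // addNr.
by rewrite addr0 det_lblock mulmxA [- _ + _]addrC.
Qed.

(** Both sides come from the determinant of the block matrix with rows [a%:M, - X] and [Y, 1%:M],
    computed through either Schur complement. *)
Lemma det_sylvester (F : fieldType) n m (X : 'M[F]_(n, m)) (Y : 'M_(m, n)) a :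
  a != 0 -> a ^+ n * \det (a%:M + Y *m X) = a ^+ m * \det (a%:M + X *m Y).
Proof.
move=> a0; have ua : a%:M \in @unitmx F n by rewrite unitmxE det_scalar unitfE
  expf_neq0.
have := det_schur_ul (- X) Y 1%:M ua.
rewrite det_schur_dr ?unitmx1 // det1 mul1r invmx1 mulmx1 mulNmx opprK det_scalar.
move=> ->; rewrite mulrCA; congr (_ * _); rewrite -detZ; congr (\det _).
by rewrite invmx_scalar mulmxN opprK mul_mx_scalar -scalemxAl scalerDr scalerA
  mulfV // scale1r scalemx1.
Qed.

(** After elimination there remains [phi], quadratic in [B^T B], minus a multiple of the all-ones
    matrix; [w] is the eigenvalue of [phi] on the all-ones vector. The powers of [p], [q] and [w]
    clear denominators. *)
Lemma det_total_block (F : fieldType) n m (B : 'M[F]_(n, m)) (p q s c r : F)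
    (w := (p - s * (2 * r)) * (q - s * (2 * r)) - s ^+ 2 * (2 * r))
    (Z := s *: (B *m B^T)) :
  B *m (const_mx 1 : 'M_m) = const_mx r ->
  B^T *m (const_mx 1 : 'M_(n, m)) = const_mx 2 ->
  p != 0 -> q != 0 ->
  p ^+ m * w ^+ m * (p * q) ^+ n *
    \det (block_mx (p%:M - Z) (- (s *: B)) (- (s *: B^T))
                   (q%:M - s *: (B^T *m B) - const_mx c)) =
  p ^+ n * (p * q) ^+ m * \det (w%:M - const_mx (c * (p - s * (2 * r))) : 'M_m) *
    \det ((p%:M - Z) *m (q%:M - Z) - s *: Z).
Proof.
move=> B1 BT1 p0 q0; set E := (X in block_mx _ _ _ X).
pose J : 'M[F]_m := const_mx 1; pose L := B^T *m B.
have constE k l a : const_mx a = a *: const_mx 1 :> 'M[F]_(k, l).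
  by apply/matrixP => i j; rewrite !mxE mulr1.
have LJ : L *m J = (2 * r) *: J.
  by rewrite -mulmxA B1 constE -scalemxAr BT1 constE scalerA mulrC.
pose V := (p%:M - s *: L) *m E - s ^+ 2 *: L.
pose phi := (p%:M - s *: L) *m (q%:M - s *: L) - s ^+ 2 *: L.
(* Subtracting B times the second block row from the first makes the upper left
   block scalar. *)
have detV : p ^+ m * \det (block_mx (p%:M - Z) (- (s *: B)) (- (s *: B^T)) E) =
  p ^+ n * \det V.
  have up : p%:M \in @unitmx F n by rewrite unitmxE det_scalar unitfE expf_neq0.
  have := congr1 determinant (mulmx_block 1%:M (- B) 0 1%:M
     (p%:M - Z) (- (s *: B)) (- (s *: B^T)) E).
  rewrite det_mulmx det_ublock !det1 !mul1r !mul1mx !mul0mx !add0r.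
  rewrite !mulNmx mulmxN opprK -scalemxAr subrK => ->.
  rewrite det_schur_ul // det_scalar mulrCA -detZ; congr (_ * \det _).
  rewrite invmx_scalar mul_mx_scalar scalerDr scalerN -scalemxAl scalerA mulfV //
    scale1r.
  rewrite /V mulmxBl mul_scalar_mx -addrA; congr (_ + _).
  rewrite mulNmx opprK mulmxBr mulmxN -!scalemxAl -!scalemxAr scalerA -expr2 mulmxA.
  by rewrite addrC.
have VE : V = phi - (c * (p - s * (2 * r))) *: J.
  have -> : c * (p - s * (2 * r)) *: J = (p%:M - s *: L) *m (c *: J).
    by rewrite -scalemxAr mulmxBl mul_scalar_mx -scalemxAl LJ !scalerA -scalerBl
      scalerA.
  rewrite /V addrAC -mulmxBr; congr (_ *m _ - _).
  by rewrite /E [const_mx c]constE.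
have phiJ : phi *m J = w *: J.
  have JE a : (a%:M - s *: L) *m J = (a - s * (2 * r)) *: J.
    by rewrite mulmxBl mul_scalar_mx -scalemxAl LJ scalerA -scalerBl.
  rewrite /phi mulmxBl -mulmxA JE -scalemxAr JE -scalemxAl LJ !scalerA -scalerBl.
  by rewrite /w mulrC.
(* With [t = c * (p - s * (2 * r))], the relation [phi J = w J] gives
   [phi (w - t J) = w (phi - t J) = w V], which splits off the all-ones perturbation. *)
have detphi : \det phi * \det (w%:M - const_mx (c * (p - s * (2 * r))) : 'M_m) =
  w ^+ m * \det V.
  rewrite -det_mulmx -detZ; congr (\det _).
  rewrite mulmxBr mul_mx_scalar constE -scalemxAr phiJ VE [RHS]scalerBr !scalerA.
  by rewrite [w * _]mulrC.
have detZ : (p * q) ^+ n * \det phi =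
  (p * q) ^+ m * \det ((p%:M - Z) *m (q%:M - Z) - s *: Z).
  have quadE k (Y : 'M[F]_k) :
      (p%:M - Y) *m (q%:M - Y) = (p * q)%:M + (Y *m Y - (p + q) *: Y).
    rewrite mulmxBl !mulmxBr !mul_scalar_mx mul_mx_scalar scale_scalar_mx scalerDl.
    by rewrite opprB opprD -addrA; congr (_ + _); rewrite addrCA.
  (* Chosen so that [phi = p q + B^T X]; the Sylvester identity then trades [B^T X] for [X B^T], a
     polynomial in [Z]. *)
  pose X := s ^+ 2 *: (B *m L) - (s * (p + q + s)) *: B.
  have -> : \det phi = \det ((p * q)%:M + B^T *m X).
    congr (\det _); have LL : B^T *m (B *m L) = L *m L by rewrite mulmxA.
    rewrite /phi quadE -addrA mulmxBr -!scalemxAr LL -scalemxAl !scalerA -expr2.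
    congr (_ + _); rewrite -addrA -opprD -scalerDl; congr (_ - _ *: _).
    by rewrite mulrDr -expr2 [_ * s]mulrC.
  rewrite det_sylvester ?mulf_neq0 //; congr (_ * \det _).
  have -> : X *m B^T = Z *m Z - (p + q + s) *: Z.
    rewrite mulmxBl -!scalemxAl -scalemxAr !scalerA -expr2 [s * _]mulrC.
    by rewrite /L !mulmxA.
  by rewrite [(p + q + s) *: _]scalerDl opprD quadE !addrA.
have -> : forall D, p ^+ m * w ^+ m * (p * q) ^+ n * D =
    (p * q) ^+ n * (w ^+ m * (p ^+ m * D)) by move=> D; ring.
rewrite detV [w ^+ m * _]mulrCA -detphi.
by rewrite [LHS]mulrCA [(p * q) ^+ n * _]mulrA detZ; ring.
Qed.

(** In [det_total_block] the matrix [B] enters the right-hand side only through its dimensions and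
    the determinant of a polynomial in [Z], a similarity invariant; the nonzero factors on the left
    cancel. *)
Lemma det_total_block_similar (F : fieldType) n1 n2 m1 m2
    (B1 : 'M[F]_(n1, m1)) (B2 : 'M[F]_(n2, m2)) (p q s c r : F) :
  n1 = n2 -> m1 = m2 ->
  B1 *m (const_mx 1 : 'M_m1) = const_mx r ->
  B1^T *m (const_mx 1 : 'M_(n1, m1)) = const_mx 2 ->
  B2 *m (const_mx 1 : 'M_m2) = const_mx r ->
  B2^T *m (const_mx 1 : 'M_(n2, m2)) = const_mx 2 ->
  p != 0 -> q != 0 ->
  (p - s * (2 * r)) * (q - s * (2 * r)) - s ^+ 2 * (2 * r) != 0 ->
  similar_mx (s *: (B1 *m B1^T)) (s *: (B2 *m B2^T)) ->
  \det (block_mx (p%:M - s *: (B1 *m B1^T)) (- (s *: B1)) (- (s *: B1^T))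
                 (q%:M - s *: (B1^T *m B1) - const_mx c)) =
  \det (block_mx (p%:M - s *: (B2 *m B2^T)) (- (s *: B2)) (- (s *: B2^T))
                 (q%:M - s *: (B2^T *m B2) - const_mx c)).
Proof.
move=> eqn eqm; case: n2 / eqn B2 => B2; case: m2 / eqm B2 => B2.
move=> B1r B1c B2r B2c p0 q0 w0 [S [T [ST TS ZS]]].
have := det_total_block s c B1r B1c p0 q0;
  have := det_total_block s c B2r B2c p0 q0.
set Z1 := s *: (B1 *m _) in ZS *; set Z2 := s *: (B2 *m _) in ZS *.
have -> : \det ((p%:M - Z1) *m (q%:M - Z1) - s *: Z1) =
    \det ((p%:M - Z2) *m (q%:M - Z2) - s *: Z2).
  have ZSa a : (a%:M - Z1) *m S = S *m (a%:M - Z2).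
    by rewrite mulmxBl mulmxBr ZS mul_scalar_mx mul_mx_scalar.
  have fS : ((p%:M - Z1) *m (q%:M - Z1) - s *: Z1) *m S =
      S *m ((p%:M - Z2) *m (q%:M - Z2) - s *: Z2).
    by rewrite mulmxBl [RHS]mulmxBr -[in LHS]mulmxA !ZSa !mulmxA ZSa -scalemxAl
      -scalemxAr ZS.
  rewrite -[LHS]mulr1 -(det1 _ n1) -ST det_mulmx mulrA -det_mulmx fS.
  by rewrite !det_mulmx mulrAC -det_mulmx ST det1 mul1r.
move=> <- /mulfI; apply; rewrite mulf_neq0 ?expf_neq0 ?mulf_neq0 ?expf_neq0 //.
Qed.

(** * Characteristic matrices of graphs *)

(** Entry of [x I - a D - s A], indexed by vertices so that any enumeration may be used. The scalars
    are free because [x] will be shifted and all three will become rational functions. *)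
Definition charmx_entry (F : comNzRingType) (x a s : F) (G : sgraph)
    (u v : G) : F :=
  (x - a * (degree u)%:R) *+ (u == v) - s * (adj u v)%:R.

Definition charmx (F : comNzRingType) (x a s : F) (G : sgraph) : 'M[F]_#|G| :=
  \matrix_(i, j) charmx_entry x a s (enum_val i) (enum_val j).

Lemma map_char_poly_mx_Aalpha (R : realType) (F : comNzRingType)
    (psi : {rmorphism {poly R} -> F}) (alpha : R) (G : sgraph) :
  map_mx psi (char_poly_mx (Aalpha alpha G)) =
  charmx (psi 'X) (psi alpha%:P) (psi (1 - alpha)%:P) G.
Proof.
apply/matrixP => i j; rewrite !mxE /charmx_entry (inj_eq enum_val_inj).
have -> : (alpha * ((degree (enum_val i))%:R *+ (i == j)) +
    (1 - alpha) * (adj (enum_val i) (enum_val j))%:R)%:P =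
    alpha%:P * (degree (enum_val i))%:R *+ (i == j) +
    (1 - alpha)%:P * (adj (enum_val i) (enum_val j))%:R :> {poly R}.
  rewrite polyCD !polyCM polyCMn !polyC_natr.
  by congr (_ + _); rewrite -[RHS]mulrnAr.
by rewrite rmorphB rmorphD !rmorphMn !rmorphM !rmorph_nat mulrnBl opprD addrA.
Qed.

Lemma det_charmx (R : realType) (F : comNzRingType)
    (psi : {rmorphism {poly R} -> F}) (alpha : R) (G : sgraph) :
  \det (charmx (psi 'X) (psi alpha%:P) (psi (1 - alpha)%:P) G) =
  psi (char_poly (Aalpha alpha G)).
Proof. by rewrite -map_char_poly_mx_Aalpha det_map_mx. Qed.

(** * The incidence matrix and the block form of the join *)

Definition incidence (F : pzRingType) (G : sgraph) : 'M[F]_(#|G|, #|edge G|) :=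
  \matrix_(i, j) ((enum_val i : G) \in val (enum_val j : edge G))%:R.

Lemma incidence_mulT (F : pzRingType) (G : sgraph) r i j :
  (forall x : G, degree x = r) ->
  (incidence F G *m (incidence F G)^T) i j =
  (adj (enum_val i) (enum_val j))%:R + r%:R *+ (i == j).
Proof.
move=> reg; rewrite mxE -(inj_eq enum_val_inj) -mulrnA -natrD.
have := sum_incident2 (enum_val i) (enum_val j); rewrite reg mulnC => <-.
rewrite natr_sum (big_enum_val (fun e : edge G => (_ * _)%:R)).
by apply: eq_bigr => k _; rewrite !mxE natrM.
Qed.

Lemma incidenceT_mul (F : pzRingType) (G : sgraph) i j :
  ((incidence F G)^T *m incidence F G) i j =
  ((enum_val i != enum_val j) &&
    (val (enum_val i) :&: val (enum_val j) != set0))%:R + 2 *+ (i == j).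
Proof.
rewrite mxE -(inj_eq enum_val_inj) -mulrnA -natrD.
have := sum_common_ends (enum_val i) (enum_val j); rewrite mulnC addnC => <-.
rewrite natr_sum (big_enum_val (fun x : G => (_ * _)%:R)).
by apply: eq_bigr => k _; rewrite !mxE natrM.
Qed.

Lemma incidence_mul1 (F : pzRingType) (G : sgraph) r k :
  (forall x : G, degree x = r) ->
  incidence F G *m (const_mx 1 : 'M_(_, k)) = const_mx r%:R.
Proof.
move=> reg; apply/matrixP => i j; rewrite !mxE -(reg (enum_val i)) -sum_incident.
rewrite natr_sum (big_enum_val (fun e : edge G => (_ \in val e)%:R)).
by apply: eq_bigr => l _; rewrite !mxE mulr1.
Qed.

Lemma incidenceT_mul1 (F : pzRingType) (G : sgraph) k :
  (incidence F G)^T *m (const_mx 1 : 'M_(_, k)) = const_mx 2.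
Proof.
apply/matrixP => i j; rewrite !mxE -(sum_ends (enum_val i)).
rewrite natr_sum (big_enum_val (fun x : G => (x \in _)%:R)).
by apply: eq_bigr => l _; rewrite !mxE mulr1.
Qed.

Lemma handshake (G : sgraph) r :
  (forall x : G, degree x = r) -> (#|edge G| * 2 = #|G| * r)%N.
Proof.
move=> reg; rewrite -!sum_nat_const.
rewrite -(eq_bigr _ (fun e _ => sum_ends e)) exchange_big.
by apply: eq_bigr => x _; rewrite sum_incident.
Qed.

(** Old vertices first, then new ones, then those of [H]: the order of the blocks. *)
Definition join_enum (G H : sgraph) (k : 'I_(#|G| + #|edge G| + #|H|)) :
  T_edge_join G H :=
  match split k with
  | inl l => inl (match split l with
                  | inl i => inl (enum_val i)
                  | inr e => inr (enum_val e)
                  end)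
  | inr j => inr (enum_val j)
  end.

Lemma join_enum_bij (G H : sgraph) : bijective (@join_enum G H).
Proof.
apply: inj_card_bij; last by rewrite card_ord !card_sum.
move=> k k'; rewrite /join_enum.
case: (split_ordP k) => [l|j] ->; case: (split_ordP k') => [l'|j'] -> //;
  last first.
  by case=> /enum_val_inj->.
case: (split_ordP l) => [i|e] ->; case: (split_ordP l') => [i'|e'] -> //.
  by case=> /enum_val_inj->.
by case=> /enum_val_inj->.
Qed.

(** Schur complement with respect to [H], whose vertices gain [#|edge G|] in degree, hence the shift
    in [N]. Only new vertices see [H], so the correction falls on their block alone. The terms
    [s * r%:R] and [s * 2] offset the diagonals of [B B^T] and [B^T B]. *)
Lemma det_charmx_join (F : fieldType) (x a s : F) (G H : sgraph) (r : nat)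
    (N := charmx (x - a * #|edge G|%:R) a s H) (B := incidence F G) :
  (forall x : G, degree x = r) -> N \in unitmx ->
  \det (charmx x a s (T_edge_join G H)) =
  \det N * \det (block_mx
    ((x - a * (2 * r)%:R + s * r%:R)%:M - s *: (B *m B^T)) (- (s *: B))
    (- (s *: B^T))
    ((x - a * (2 * r + #|H|)%:R + s * 2)%:M - s *: (B^T *m B) -
     const_mx (s ^+ 2 *
       ((const_mx 1 : 'cV_#|H|)^T *m invmx N *m (const_mx 1 : 'cV_#|H|)) 0 0))).
Proof.
move=> reg uN; rewrite /charmx.
rewrite (det_reindex _ (@enum_val_bij _) (@join_enum_bij G H)).
pose P := block_mx
    ((x - a * (2 * r)%:R + s * r%:R)%:M - s *: (B *m B^T)) (- (s *: B))
    (- (s *: B^T)) ((x - a * (2 * r + #|H|)%:R + s * 2)%:M - s *: (B^T *m B)).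
have -> : \matrix_(i, j) charmx_entry x a s (join_enum i) (join_enum j) =
    block_mx P (col_mx 0 (const_mx (- s))) (row_mx 0 (const_mx (- s))) N.
  apply/matrixP => i j; rewrite mxE /join_enum.
  case: (split_ordP i) => [i' ->|i' ->]; case: (split_ordP j) => [j' ->|j' ->].
  - rewrite block_mxEul.
    case: (split_ordP i') => [k ->|k ->]; case: (split_ordP j') => [l ->|l ->].
    + rewrite block_mxEul /charmx_entry (degree_old _ _ reg) /=.
      rewrite (_ : (_ == _) = (k == l));
        last by apply/eqP/eqP => [[/enum_val_inj]|->].
      have := incidence_mulT F k l reg; rewrite -/B.
      move: (B *m B^T) => BB BBE; rewrite !mxE BBE.
      by case: (_ == _); rewrite ?mulr0n ?mulr1n; ring.
    + rewrite block_mxEur /charmx_entry /= !mxE mulr0n sub0r //.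
    + rewrite block_mxEdl /charmx_entry /= !mxE mulr0n sub0r //.
    + rewrite block_mxEdr /charmx_entry (degree_new _ _ reg) /=.
      rewrite (_ : (_ == _) = (k == l));
        last by apply/eqP/eqP => [[/enum_val_inj]|->].
      have := incidenceT_mul F k l; rewrite -/B.
      move: (B^T *m B) => BB BBE; rewrite !mxE BBE.
      by case: (_ == _); rewrite ?mulr0n ?mulr1n; ring.
  - rewrite block_mxEur /charmx_entry /= mulr0n sub0r.
    case: (split_ordP i') => [k ->|k ->].
      by rewrite col_mxEu mxE mulr0 oppr0.
    by rewrite col_mxEd mxE mulr1.
  - rewrite block_mxEdl /charmx_entry /= mulr0n sub0r.
    case: (split_ordP j') => [k ->|k ->].
      by rewrite row_mxEl mxE mulr0 oppr0.
    by rewrite row_mxEr mxE mulr1.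
  - rewrite block_mxEdr /charmx_entry degree_joined !mxE /charmx_entry /=.
    by rewrite natrD mulrDr [a * _ + _]addrC opprD addrA.
rewrite det_schur_dr //; congr (_ * \det _).
rewrite mul_col_mx mul_col_row !mul0mx mulmx0 /P opp_block_mx add_block_mx !oppr0
  !addr0.
congr block_mx; congr (_ - _).
apply/matrixP => i j; rewrite !mxE expr2 -mulrA [s * _ in RHS]mulrC mulr_sumr.
rewrite mulr_suml; apply: eq_bigr => k _; rewrite !mxE mulr1 mulrN -mulNr;
  congr (_ * _).
rewrite mulr_sumr -sumrN; apply: eq_bigr => l _.
by rewrite !mxE mulNr opprK mul1r.
Qed.

(** Since [D = r I], the matrix [s B B^T] is a scalar shift of [A_alpha]. Keeping the factor [s]
    avoids dividing by [1 - alpha], which may vanish. *)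
Lemma incidence_Aalpha (R : realType) (F : comNzRingType)
    (theta : {rmorphism R -> F}) (alpha : R) (G : sgraph) r (s := theta (1 - alpha)) :
  (forall x : G, degree x = r) ->
  s *: (incidence F G *m (incidence F G)^T) =
  map_mx theta (Aalpha alpha G) + (s * r%:R - theta alpha * r%:R)%:M.
Proof.
move=> reg; apply/matrixP => i j; rewrite mxE (incidence_mulT _ _ _ reg) !mxE reg.
rewrite rmorphD !rmorphM !rmorphMn rmorph1 -/s.
by case: (i == j); rewrite ?mulr0n ?mulr1n; ring.
Qed.

Lemma similar_shift (F : comNzRingType) n1 n2 (A1 : 'M[F]_n1) (A2 : 'M[F]_n2) c :
  similar_mx A1 A2 -> similar_mx (A1 + c%:M) (A2 + c%:M).
Proof.
move=> [S [T [ST TS AS]]]; exists S, T; split=> //.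
by rewrite mulmxDl mulmxDr AS mul_scalar_mx mul_mx_scalar.
Qed.

(** * What the spectrum determines *)

Lemma spectrum_char_poly (R : realType) n1 n2 (M1 : 'M[R]_n1) (M2 : 'M[R]_n2) :
  perm_eq (spectrum M1) (spectrum M2) <-> char_poly M1 = char_poly M2.
Proof.
rewrite /spectrum; split=> [|->//].
case: closed_field_poly_normal => s1 /= e1;
  case: closed_field_poly_normal => s2 /= e2 s12.
apply: (map_poly_inj (real_complex R)); rewrite e1 e2 !lead_coef_map.
by rewrite !(monicP (char_poly_monic _)) (perm_big _ s12).
Qed.

Lemma Aalpha_similar (R : realType) (alpha : R) (G1 G2 : sgraph) :
  char_poly (Aalpha alpha G1) = char_poly (Aalpha alpha G2) ->
  similar_mx (map_mx (real_complex R) (Aalpha alpha G1))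
             (map_mx (real_complex R) (Aalpha alpha G2)).
Proof.
move=> eqA; have nA G : map_mx (real_complex R) (Aalpha alpha G) \is normalmx.
  apply: symmetric_normalmx.
    apply/is_hermitianmxP; rewrite expr0 scale1r; apply/matrixP => i j;
      rewrite !mxE.
    by rewrite adj_sym eq_sym; case: eqP => [->|]//.
  by apply/mxOverP => i j; rewrite !mxE; apply/complex_realP; eexists.
by apply: normal_similar => //; rewrite -!map_char_poly eqA.
Qed.

Lemma similar_trace_sqr (F : comNzRingType) n1 n2 (A1 : 'M[F]_n1) (A2 : 'M[F]_n2) :
  similar_mx A1 A2 -> \tr (A1 *m A1) = \tr (A2 *m A2).
Proof.
move=> [S [T [ST TS AS]]].
rewrite -[A1 *m A1]mulmx1 -ST mulmxA -[_ *m S]mulmxA AS mulmxA AS -!mulmxA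
  mxtrace_mulC.
by rewrite -!mulmxA TS mulmx1.
Qed.

Lemma trace_Aalpha_sqr (R : realType) (alpha : R) (G : sgraph) r :
  (forall x : G, degree x = r) ->
  \tr (Aalpha alpha G *m Aalpha alpha G) =
  #|G|%:R * (alpha ^+ 2 * r%:R ^+ 2 + (1 - alpha) ^+ 2 * r%:R).
Proof.
move=> reg; rewrite mulr_natl -[in RHS](card_ord #|G|) -sumr_const.
apply: eq_bigr => i _; rewrite mxE.
have -> : alpha ^+ 2 * r%:R ^+ 2 + (1 - alpha) ^+ 2 * r%:R =
    \sum_j (alpha ^+ 2 * r%:R ^+ 2 *+ (i == j) +
            (1 - alpha) ^+ 2 * (adj (enum_val i) (enum_val j))%:R).
  rewrite big_split /= (bigD1 i) //= eqxx [X in _ + X + _]big1 ?addr0 => [|j];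
    last first.
    by rewrite eq_sym => /negbTE->.
  rewrite -mulr_sumr; congr (_ + _ * _).
  rewrite -(reg (enum_val i)) degree_sum natr_sum.
  by rewrite (big_enum_val (fun y : G => (adj (enum_val i) y)%:R)).
apply: eq_bigr => j _; rewrite !mxE !reg [adj (enum_val j) _]adj_sym [j == i]eq_sym.
case: (i =P j) => [->|_].
  by rewrite adj_irrefl /= ?mulr0n ?mulr1n; ring.
by rewrite !mulr0n; case: (adj _ (enum_val j)); rewrite ?mulr0n ?mulr1n; ring.
Qed.

Lemma cospectral_degree (R : realType) (alpha : R) (G1 G2 : sgraph) r1 r2 :
  (forall x : G1, degree x = r1) -> (forall x : G2, degree x = r2) ->
  char_poly (Aalpha alpha G1) = char_poly (Aalpha alpha G2) -> r1 = r2.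
Proof.
move=> reg1 reg2 eqA; have eqn := char_poly_order eqA.
have := similar_trace_sqr (Aalpha_similar eqA).
rewrite -!map_mxM !trace_map_mx => /(fmorph_inj (real_complex R)).
rewrite (trace_Aalpha_sqr _ reg1) (trace_Aalpha_sqr _ reg2) eqn.
have n0 : #|G2|%:R != 0 :> R by rewrite pnatr_eq0 -lt0n vertex_gt0.
move=> /(mulfI n0) eqr; apply/eqP; rewrite -(eqr_nat R); apply/eqP.
have r1_ge0 : 0 <= r1%:R :> R by []. have r2_ge0 : 0 <= r2%:R :> R by [].
move: (r1%:R) (r2%:R) r1_ge0 r2_ge0 eqr => x y x0 y0 eqxy.
(* The difference of the two trace expressions factors. The second factor is a sum of nonnegative
   terms and vanishes only if [alpha = 1] and [x + y = 0], in which case both degrees are 0. *)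
have /eqP : (x - y) * (alpha ^+ 2 * (x + y) + (1 - alpha) ^+ 2) = 0.
  transitivity (alpha ^+ 2 * x ^+ 2 + (1 - alpha) ^+ 2 * x -
                (alpha ^+ 2 * y ^+ 2 + (1 - alpha) ^+ 2 * y)); first by ring.
  by rewrite eqxy subrr.
rewrite mulf_eq0 subr_eq0 => /orP[/eqP//|].
rewrite paddr_eq0 ?sqr_ge0 ?(mulr_ge0 (sqr_ge0 _)) ?addr_ge0 // => /andP[e1].
rewrite sqrf_eq0 subr_eq0 => /eqP a1; move: e1.
by rewrite -a1 expr1n mul1r paddr_eq0 // => /andP[/eqP-> /eqP->].
Qed.

(** * Cospectral joins *)

(** Extends scalars along [iota], substitutes ['X + c] for the variable and passes to rational
    functions. Part (a) takes [K] complex, where the similarity lives; part (b) stays over [R]. *)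
Definition shift_frac (R K : fieldType) (iota : {rmorphism R -> K}) (c : K) :
    {poly R} -> {fraction {poly K}} :=
  @FracField.tofrac {poly K} \o comp_poly ('X + c%:P) \o map_poly iota.

HB.instance Definition _ (R K : fieldType) (iota : {rmorphism R -> K}) (c : K) :=
  GRing.RMorphism.on (shift_frac iota c).

Lemma shift_fracX (R K : fieldType) (iota : {rmorphism R -> K}) (c : K) :
  shift_frac iota c 'X = FracField.tofrac 'X + FracField.tofrac c%:P.
Proof. by rewrite /shift_frac /= map_polyX comp_polyX rmorphD. Qed.

Lemma shift_fracC (R K : fieldType) (iota : {rmorphism R -> K}) (c : K) (k : R) :
  shift_frac iota c k%:P = FracField.tofrac (iota k)%:P.
Proof. by rewrite /shift_frac /= map_polyC comp_polyC. Qed.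

Lemma shift_frac_inj (R K : fieldType) (iota : {rmorphism R -> K}) (c : K) :
  injective (shift_frac iota c).
Proof.
move=> p q /eqP; rewrite /shift_frac /= tofrac_eq => /eqP.
move=> /(congr1 (comp_poly ('X - c%:P))); rewrite -!comp_polyA.
rewrite comp_polyD comp_polyX comp_polyC subrK !comp_polyXr.
exact: map_poly_inj.
Qed.

(** At the shifted argument the block of [H] becomes its own characteristic matrix in [y], so its
    coronal appears unshifted. The separate [m] lets two graphs with equally many edges share one
    shift. *)
Lemma char_poly_T_edge_join (R : realType) (K : fieldType)
    (iota : {rmorphism R -> K}) (alpha : R) (G H : sgraph) (r m : nat) (B := incidence {fraction {poly K}} G)
    (y := FracField.tofrac ('X : {poly K})) (a := FracField.tofrac (iota alpha)%:P)
    (s := FracField.tofrac (iota (1 - alpha))%:P) (N := charmx y a s H) :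
  (forall x : G, degree x = r) -> #|edge G| = m ->
  shift_frac iota (iota alpha * m%:R) (char_poly (Aalpha alpha (T_edge_join G H))) =
  \det N * \det (block_mx
    ((y + a * m%:R - a * (2 * r)%:R + s * r%:R)%:M - s *: (B *m B^T)) (- (s *: B))
    (- (s *: B^T))
    ((y + a * m%:R - a * (2 * r + #|H|)%:R + s * 2)%:M - s *: (B^T *m B) -
     const_mx (s ^+ 2 *
       ((const_mx 1 : 'cV_#|H|)^T *m invmx N *m (const_mx 1 : 'cV_#|H|)) 0 0))).
Proof.
move=> reg em; rewrite -det_charmx /= shift_fracX !shift_fracC -/y -/a -/s.
rewrite polyCM polyC_natr rmorphM rmorph_nat -/a -em.
have uN : N \in unitmx.
  have -> : N = map_mx (@FracField.tofrac {poly K} \o map_poly iota)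
    (char_poly_mx (Aalpha alpha H)).
    by rewrite map_char_poly_mx_Aalpha /= map_polyX !map_polyC.
  rewrite unitmxE det_map_mx unitfE /= tofrac_eq0 map_poly_eq0 -/(char_poly _).
  by rewrite monic_neq0 // char_poly_monic.
by have := @det_charmx_join _ (y + a * #|edge G|%:R) a s G H r reg;
  rewrite addrK => ->.
Qed.

(** A monic quadratic differs from a constant. This gives the nonvanishing of [w] when [p] and [q]
    are the variable plus constants. *)
Lemma tofrac_quadratic_neq0 (K : fieldType) (k1 k2 k3 : K) :
  FracField.tofrac ('X + k1%:P) * FracField.tofrac ('X + k2%:P) -
    FracField.tofrac k3%:P != 0.
Proof.
rewrite -rmorphM -rmorphB tofrac_eq0 subr_eq0; apply/eqP => e.
have := size_polyC_leq1 k3; rewrite -e size_mul -?size_poly_eq0 !size_XaddC //.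
Qed.

Lemma char_poly_join_left (R : realType) (alpha : R) (G1 G2 H : sgraph) r :
  (forall x : G1, degree x = r) -> (forall x : G2, degree x = r) ->
  char_poly (Aalpha alpha G1) = char_poly (Aalpha alpha G2) ->
  char_poly (Aalpha alpha (T_edge_join G1 H)) =
    char_poly (Aalpha alpha (T_edge_join G2 H)).
Proof.
move=> reg1 reg2 eqA; have eqn := char_poly_order eqA.
have eqm : #|edge G1| = #|edge G2|.
  by apply/eqP; rewrite -(@eqn_pmul2r 2) // (handshake reg1) (handshake reg2) eqn.
set m := #|edge G2| in eqm.
pose iota := real_complex R.
apply: (@shift_frac_inj _ _ iota (iota alpha * m%:R)).
rewrite (char_poly_T_edge_join iota alpha H reg1 eqm).
rewrite (char_poly_T_edge_join iota alpha H reg2 (erefl m)).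
set y := FracField.tofrac 'X; set a := FracField.tofrac (iota alpha)%:P.
set s := FracField.tofrac (iota (1 - alpha))%:P.
have shiftE k1 : y + FracField.tofrac k1%:P =
  FracField.tofrac ('X + k1%:P) by rewrite rmorphD.
have [toC toCE] : exists toC : {rmorphism R[i] -> {fraction {poly R[i]}}},
    forall k, FracField.tofrac k%:P =
      toC k by exists (@FracField.tofrac {poly R[i]} \o polyC).
set p := y + _ - _ + _; set q := y + _ - _ + _.
have [k1 pE] : exists k, p = FracField.tofrac ('X + k%:P).
  exists (iota alpha * m%:R - iota alpha * (2 * r)%:R + iota (1 - alpha) * r%:R).
  by rewrite -shiftE toCE !(rmorphD toC) (rmorphN toC) !(rmorphM toC)
    !(rmorph_nat toC) -!toCE !addrA.
have [k2 qE] : exists k, q = FracField.tofrac ('X + k%:P).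
  exists (iota alpha * m%:R - iota alpha * (2 * r + #|H|)%:R + iota (1 - alpha) *
    2).
  by rewrite -shiftE toCE !(rmorphD toC) (rmorphN toC) !(rmorphM toC)
    !(rmorph_nat toC) -!toCE !addrA.
have tX_neq0 k : FracField.tofrac ('X + k%:P) != 0 :> {fraction {poly R[i]}}.
  by rewrite tofrac_eq0 -size_poly_eq0 size_XaddC.
have tXB k l : FracField.tofrac ('X + k%:P) - s * (2 * l%:R) =
    FracField.tofrac ('X + (k - iota (1 - alpha) * (2 * l%:R))%:P).
  by rewrite -!shiftE !toCE (rmorphB toC) !(rmorphM toC) !(rmorph_nat toC) -!toCE
    addrA.
congr (_ * _); apply: (@det_total_block_similar _ _ _ _ _ _ _ _ _ _ _ r%:R) => //.
- exact: incidence_mul1.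
- exact: incidenceT_mul1.
- exact: incidence_mul1.
- exact: incidenceT_mul1.
- by rewrite pE.
- by rewrite qE.
- have -> : s ^+ 2 * (2 * r%:R) = toC (iota (1 - alpha) ^+ 2 * (2 * r%:R)).
    by rewrite (rmorphM toC) (rmorphXn toC) (rmorphM toC) !(rmorph_nat toC) -toCE.
  by rewrite pE qE !tXB -toCE tofrac_quadratic_neq0.
(* Similarity over the complex numbers carries over to rational functions, and then through the
   scalar shift. *)
pose theta := @FracField.tofrac {poly R[i]} \o polyC \o iota.
have -> := @incidence_Aalpha R _ theta alpha G1 r reg1.
have -> := @incidence_Aalpha R _ theta alpha G2 r reg2.
have mapE n (A : 'M[R]_n) :
    map_mx theta A = map_mx (@FracField.tofrac {poly R[i]} \o polyC) (map_mx iota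
      A).
  by apply/matrixP => i j; rewrite !mxE.
apply: similar_shift; rewrite !mapE.
exact/similar_map/Aalpha_similar.
Qed.

(** In the determinant formula [H] enters only through its order, characteristic polynomial and
    coronal. *)
Lemma char_poly_join_right (R : realType) (alpha : R) (G H1 H2 : sgraph) r :
  (forall x : G, degree x = r) ->
  coronal (Aalpha alpha H1) = coronal (Aalpha alpha H2) ->
  char_poly (Aalpha alpha H1) = char_poly (Aalpha alpha H2) ->
  char_poly (Aalpha alpha (T_edge_join G H1)) =
    char_poly (Aalpha alpha (T_edge_join G H2)).
Proof.
move=> reg eqc eqA; have eqh := char_poly_order eqA.
apply: (@shift_frac_inj _ _ idfun (alpha * #|edge G|%:R)).
rewrite !(char_poly_T_edge_join idfun _ _ reg erefl) /=.
rewrite -!(map_char_poly_mx_Aalpha (@FracField.tofrac {poly R})).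
by rewrite !det_map_mx -/(coronal _) -/(coronal _) eqc -!/(char_poly _) eqA eqh.
Qed.

Theorem corollary6p3 (R : realType) (alpha : R) (h_alpha : 0 <= alpha <= 1) :
  (forall G1 G2 H : sgraph,
     regular G1 -> regular G2 ->
     cospectral alpha G1 G2 ->
     cospectral alpha (T_edge_join G1 H) (T_edge_join G2 H))
  /\
  (forall G H1 H2 : sgraph,
     regular G ->
     coronal (Aalpha alpha H1) = coronal (Aalpha alpha H2) ->
     cospectral alpha H1 H2 ->
     cospectral alpha (T_edge_join G H1) (T_edge_join G H2)).
Proof.
split=> [G1 G2 H [r reg1] [r' reg2'] [niso /spectrum_char_poly eqA]|
         G H1 H2 [r reg] eqc [niso /spectrum_char_poly eqA]].
  have eqn := char_poly_order eqA.
  have er := cospectral_degree reg1 reg2' eqA; case: r' / er reg2' => reg2.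
  split; last by apply/spectrum_char_poly; exact: char_poly_join_left reg1 reg2 eqA.
  move/(dunion_of_join reg1 reg2 eqn erefl) => iso; apply: niso.
  (* Here the common summand [H] stands on the right, so both unions are swapped before
     cancelling. *)
  apply: (@dunion_cancel H); apply: isomorphic_trans (dunionC _ _) _.
  exact: isomorphic_trans iso (dunionC _ _).
split; last by apply/spectrum_char_poly; exact: char_poly_join_right reg eqc eqA.
by move/(dunion_of_join reg reg erefl (char_poly_order eqA))/dunion_cancel.
Qed.
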